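(* Let $(\mathcal{A},\varphi)$ be a noncommutative probability space. Let $n\ge1$, let $t\in\mathrm{ST}(n)$ and let $w=a_1\cdots a_n$ be a word with $a_1,\dots,a_n\in\mathcal{A}$. Let $\tilde\Phi\colon H_{\mathcal{S}}(\mathcal{A})\to\mathbb{C}$ be the character extending $\varphi$, and let $\tilde\beta\colon H_{\mathcal{S}}(\mathcal{A})\to\mathbb{C}$ be the infinitesimal character satisfying $\tilde\Phi=\varepsilon_{\mathcal{A}}+\tilde\Phi\,\tilde\succ\,\tilde\beta$. Then $$\tilde\beta(t\otimes w)=\begin{cases}(-1)^{i(t)-1}\varphi_{\pi(t)}(a_1,\dots,a_n)&\text{if }t\in\mathrm{BST}(n),\\ 0&\text{otherwise.}\end{cases}$$ Here $i(t)$ is the number of internal vertices of $t$, and $\mathrm{BST}(n)$ is the set of Schröder trees $t$ with $n+1$ leaves obtained as follows: starting from the single-vertex tree, one repeatedly grafts a corolla on the leftmost leaf of the current tree until one gets $t$.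
   Context: Noncommutative probability space: a pair $(\mathcal{A},\varphi)$ with $\mathcal{A}$ a unital (associative) algebra over $\mathbb{C}$ and $\varphi\colon\mathcal{A}\to\mathbb{C}$ linear with $\varphi(1_{\mathcal{A}})=1$. Schröder trees: planar rooted trees in which every internal (non-leaf) vertex has at least two children; $\mathrm{ST}(n)$ is the set of those with $n+1$ leaves; $\circ$ is the single-vertex tree, the unique element of $\mathrm{ST}(0)$. A corolla is a tree with exactly one internal vertex (the root, with at least two leaf children). Partition $\pi(t)$ and $\varphi_{\pi}$: for $t\in\mathrm{ST}(n)$ label the $n$ sectors between consecutive leaves from left to right by $1,\dots,n$. For each internal vertex $v$, the sectors between consecutive children of $v$ form a block of $\pi(t)$ (equivalently, $i$ is in the block of $v$ iff $v$ is the last common ancestor of the $i$-th and $(i+1)$-st leaves). This is a noncrossing partition of $\{1,\dots,n\}$. For a partition $\pi$, $\varphi_\pi(a_1,\dots,a_n)=\prod_{V\in\pi}\varphi(a_{i_1}\cdots a_{i_s})$, where $V=\{i_1<\dots<i_s\}$. The Hopf algebra $H_{\mathcal{S}}(\mathcal{A})$: $H_{\mathcal{S}}$ is the free noncommutative unital $\mathbb{C}$-algebra on the Schröder trees, modulo the identification $\circ=1$; its monomials are ordered forests. It is graded by $\deg(t)=n$ for $t\in\mathrm{ST}(n)$, additively on forests, with homogeneous components $H_{\mathcal{S}}(n)$. Then $H_{\mathcal{S}}(\mathcal{A})=\bigoplus_{n\ge0}H_{\mathcal{S}}(n)\otimes\mathcal{A}^{\otimes n}$, with product $(f\otimes u)(g\otimes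 v)=fg\otimes uv$ ($uv$ is the concatenation in the tensor algebra $T(\mathcal{A})$; elements of $\mathcal{A}^{\otimes n}$ are written as words $a_1\cdots a_n$). For $t\in\mathrm{ST}(n)$, $t\otimes a_1\cdots a_n$ is viewed as $t$ with its sectors decorated from left to right by $a_1,\dots,a_n$. An admissible cut of $t$ is a (possibly empty) set $c$ of internal vertices such that every path from the root to a leaf contains at most one element of $c$; $\mathrm{Adm}(t)$ is the set of these. $P_c(t)$ is the ordered (left to right) forest of the subtrees of $t$ rooted at the elements of $c$, and $R_c(t)$ is the tree obtained from $t$ by replacing each of these subtrees by a leaf (if $c=\{\text{root}\}$ then $R_c(t)=\circ$, $P_c(t)=t$). $R_c(t\otimes w)$ and $P_c(t\otimes w)$ are the same objects carrying the decorations of their sectors. The coproduct is the algebra morphism $\delta_{\mathcal{A}}\colon H_{\mathcal{S}}(\mathcal{A})\to H_{\mathcal{S}}(\mathcal{A})\otimes H_{\mathcal{S}}(\mathcal{A})$ with $\delta_{\mathcal{A}}(t\otimes w)=\sum_{c\in\mathrm{Adm}(t)}R_c(t\otimes w)\otimes P_c(t\otimes w)$, and the counit $\varepsilon_{\mathcal{A}}$ is $1$ on the unit and $0$ on positive degree. Half-coproducts: $\mathrm{Adm}_\prec(t)$ is the set of $c\in\mathrm{Adm}(t)$ such that $R_c(t)$ contains the leftmost leaf of $t$, i.e. no element of $c$ is an ancestor of the leftmost leaf. On decorated trees of positive degree, $\delta_{\prec,\mathcal{A}}(t\otimes w)=\sum_{c\in\mathrm{Adm}_\prec(t)}R_c(t\otimes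 w)\otimes P_c(t\otimes w)$ and $\delta_{\succ,\mathcal{A}}(t\otimes w)=\delta_{\mathcal{A}}(t\otimes w)-\delta_{\prec,\mathcal{A}}(t\otimes w)$; on products of decorated trees of positive degree, $\delta_{\succ,\mathcal{A}}(x_1x_2\cdots x_m)=\delta_{\succ,\mathcal{A}}(x_1)\,\delta_{\mathcal{A}}(x_2\cdots x_m)$. For linear functionals $f,g$ on $H_{\mathcal{S}}(\mathcal{A})$, $f\,\tilde\succ\,g=m_{\mathbb{C}}\circ(f\otimes g)\circ\delta_{\succ,\mathcal{A}}$ on the augmentation ideal (elements of positive degree), with value $0$ on the unit; $m_{\mathbb{C}}$ is multiplication in $\mathbb{C}$. Characters: a character is a unital algebra morphism $H_{\mathcal{S}}(\mathcal{A})\to\mathbb{C}$; an infinitesimal character is a linear functional vanishing on the unit and on products of two or more elements of the augmentation ideal. $\tilde\Phi$ is the character with $\tilde\Phi(\circ)=1$ and, for $n\ge1$, $\tilde\Phi(t\otimes a_1\cdots a_n)=\varphi(a_1\cdots a_n)$ (product in $\mathcal{A}$) if $t$ is the corolla with $n+1$ leaves and $0$ for any other $t\in\mathrm{ST}(n)$. *)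

(* Defs.v *)
From HB Require Import structures.
From mathcomp Require Import all_boot all_order all_algebra finmap.
From mathcomp Require Import generic_quotient.
From mathcomp Require Import boolp reals complex.
From mathcomp Require Import monalg.

Set Implicit Arguments.
Unset Strict Implicit.
Unset Printing Implicit Defensive.

Import GRing.Theory.
Local Open Scope ring_scope.
Local Open Scope quotient_scope.

(** * Vector spaces given by generators and linear relations *)

Section Presentation.
Variables (K : fieldType) (X : choiceType) (rel : {malg K[X]} -> Prop).

Inductive relspan : {malg K[X]} -> Prop :=
| relspan0 : relspan 0
| relspanP k r x of rel r & relspan x : relspan (k *: r + x).

Lemma relspanD x y : relspan x -> relspan y -> relspan (x + y).
Proof.
elim=> [|k r {}x hr _ IH] hy; first by rewrite add0r.
by rewrite -addrA; apply: relspanP => //; exact: IH.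
Qed.

Lemma relspanZ k x : relspan x -> relspan (k *: x).
Proof.
elim=> [|l r {}x hr _ IH]; first by rewrite scaler0; exact: relspan0.
by rewrite scalerDr scalerA; exact: relspanP.
Qed.

Definition pres_rel (x y : {malg K[X]}) : bool := `[< relspan (x - y) >].

Lemma pres_rel_refl : reflexive pres_rel.
Proof. by move=> x; apply/asboolP; rewrite subrr; exact: relspan0. Qed.

Lemma pres_rel_sym : symmetric pres_rel.
Proof.
move=> x y; apply/asboolP/asboolP => h; rewrite -opprB -scaleN1r;
  exact: relspanZ.
Qed.

Lemma pres_rel_trans : transitive pres_rel.
Proof.
move=> y x z /asboolP h1 /asboolP h2; apply/asboolP.
by rewrite -(subrK y x) -addrA; exact: relspanD.
Qed.

Canonical pres_equiv := EquivRel pres_rel pres_rel_refl pres_rel_sym pres_rel_trans.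

Definition pres : Type := {eq_quot pres_equiv}.
HB.instance Definition _ := Choice.on pres.
HB.instance Definition _ := Quotient.on pres.

Lemma presE (x y : {malg K[X]}) :
  reflect (relspan (x - y)) (\pi_pres x == \pi_pres y).
Proof. by rewrite eqmodE; exact: asboolP. Qed.

(* The operations are locked: unfolding them, which unification would attempt,
   leads into the choice of representatives. *)
Fact pres_key : unit. Proof. by []. Qed.

Definition pres_add (p q : pres) : pres :=
  locked_with pres_key (\pi_pres (repr p + repr q)).
Definition pres_opp (p : pres) : pres :=
  locked_with pres_key (\pi_pres (- repr p)).
Definition pres_scale (k : K) (p : pres) : pres :=
  locked_with pres_key (\pi_pres (k *: repr p)).

Lemma repr_pres x : relspan (repr (\pi_pres x) - x).
Proof. by apply/presE; rewrite reprK. Qed.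

Lemma pres_piD x y : \pi_pres (x + y) = pres_add (\pi_pres x) (\pi_pres y).
Proof.
rewrite [RHS]unlock; apply/eqP; rewrite eq_sym; apply/presE; rewrite opprD addrACA.
by apply: relspanD; exact: repr_pres.
Qed.

Lemma pres_piN x : \pi_pres (- x) = pres_opp (\pi_pres x).
Proof.
rewrite [RHS]unlock; apply/eqP; rewrite eq_sym; apply/presE; rewrite -opprD -scaleN1r.
by apply: relspanZ; exact: repr_pres.
Qed.

Lemma pres_piZ k x : \pi_pres (k *: x) = pres_scale k (\pi_pres x).
Proof.
rewrite [RHS]unlock; apply/eqP; rewrite eq_sym; apply/presE; rewrite -scalerBr.
by apply: relspanZ; exact: repr_pres.
Qed.

Lemma pres_addA : associative pres_add.
Proof.
elim/quotW=> x; elim/quotW=> y; elim/quotW=> z.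
by rewrite -(pres_piD y z) -(pres_piD x y) -(pres_piD x) -(pres_piD _ z) addrA.
Qed.

Lemma pres_addC : commutative pres_add.
Proof. by elim/quotW=> x; elim/quotW=> y; rewrite -(pres_piD x) -(pres_piD y) addrC. Qed.

Lemma pres_add0 : left_id (\pi_pres 0) pres_add.
Proof. by elim/quotW=> x; rewrite -(pres_piD 0 x) add0r. Qed.

Lemma pres_addN : left_inverse (\pi_pres 0) pres_opp pres_add.
Proof. by elim/quotW=> x; rewrite -(pres_piN x) -(pres_piD _ x) addNr. Qed.

HB.instance Definition _ :=
  GRing.isZmodule.Build pres pres_addA pres_addC pres_add0 pres_addN.

Lemma pres_scaleA k l p : pres_scale k (pres_scale l p) = pres_scale (k * l) p.
Proof. by elim/quotW: p => x; rewrite -(pres_piZ l x) -(pres_piZ k) -(pres_piZ _ x) scalerA. Qed.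

Lemma pres_scale1 : left_id 1 pres_scale.
Proof. by elim/quotW=> x; rewrite -(pres_piZ 1 x) scale1r. Qed.

Lemma pres_scaleDr : right_distributive pres_scale +%R.
Proof.
move=> k; elim/quotW=> x; elim/quotW=> y; rewrite -(pres_piZ k x) -(pres_piZ k y).
by rewrite -[_ + _ in LHS](pres_piD x y) -(pres_piZ k (x + y)) scalerDr pres_piD.
Qed.

Lemma pres_scaleDl p : {morph pres_scale^~ p : k l / k + l}.
Proof. elim/quotW: p => x k l.
by rewrite -(pres_piZ k x) -(pres_piZ l x) -(pres_piZ (k + l) x) scalerDl pres_piD. Qed.

HB.instance Definition _ := GRing.Zmodule_isLmodule.Build K pres
  pres_scaleA pres_scale1 pres_scaleDr pres_scaleDl.

Lemma pres_pi_linear : linear (\pi_pres : {malg K[X]} -> pres).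
Proof. by move=> k x y; rewrite pres_piD pres_piZ. Qed.

HB.instance Definition _ :=
  GRing.isLinear.Build K {malg K[X]} pres *:%R \pi_pres pres_pi_linear.

Definition gen (x : X) : pres := \pi_pres << x >>.

End Presentation.

(** * Linear extension of a map defined on generators *)

Section Extension.
Variables (K : fieldType) (X : choiceType) (V : lmodType K).

Definition mlext (f : X -> V) (g : {malg K[X]}) : V :=
  \sum_(x <- msupp g) g@_x *: f x.

Lemma mlextEw (f : X -> V) (d : {fset X}) g :
  (msupp g `<=` d)%fset -> mlext f g = \sum_(x <- d) g@_x *: f x.
Proof.
move=> le; rewrite /mlext (big_fset_incl _ le) // => x _ /mcoeff_outdom ->.
by rewrite scale0r.
Qed.

Lemma mlext_linear f : linear (mlext f).
Proof.
move=> k x y.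
pose d := (msupp x `|` msupp y)%fset.
have hx : (msupp x `<=` d)%fset by exact: fsubsetUl.
have hy : (msupp y `<=` d)%fset by exact: fsubsetUr.
have hxy : (msupp (k *: x + y) `<=` d)%fset.
  apply: fsubset_trans (msuppD_le _ _) _; rewrite fsubUset hy andbT.
  exact: fsubset_trans (msuppZ_le _ _) hx.
rewrite !(mlextEw _ hx) (mlextEw _ hy) (mlextEw _ hxy) scaler_sumr -big_split.
by apply: eq_bigr => i _ /=; rewrite mcoeffD mcoeffZ scalerDl scalerA.
Qed.

HB.instance Definition _ f :=
  GRing.isLinear.Build K {malg K[X]} V *:%R (mlext f) (mlext_linear f).

Lemma mlextU f x : mlext f << x >> = f x.
Proof.
by rewrite /mlext msuppU oner_eq0 big_seq_fset1 mcoeffUU scale1r.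
Qed.

Variable rel : {malg K[X]} -> Prop.

Definition respects (f : X -> V) := forall r, rel r -> mlext f r = 0.

Definition plift (f : X -> V) (p : pres rel) : V := 
  locked_with pres_key (mlext f (repr p)).

Lemma plift_pi f x : respects f -> plift f (\pi x) = mlext f x.
Proof.
move=> hf; rewrite [LHS]unlock; apply/eqP; rewrite -subr_eq0 -linearB; apply/eqP.
elim: (repr_pres rel x) => [|k r y /hf hr _ IH]; first exact: linear0.
by rewrite linearP /= hr IH scaler0 addr0.
Qed.

Lemma plift_gen f x : respects f -> plift f (gen rel x) = f x.
Proof. by move=> hf; rewrite plift_pi // mlextU. Qed.

Lemma plift_linear f : respects f -> linear (plift f).
Proof.
move=> hf k p q; rewrite -[p]reprK -[q]reprK -linearP !plift_pi //.
exact: linearP.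
Qed.

Lemma plift0 f : respects f -> plift f 0 = 0.
Proof.
by move=> hf; have := plift_linear hf (-1) 0 0; rewrite !scaleN1r !addNr.
Qed.

End Extension.

Section PresentationTheory.
Variables (K : fieldType) (X : choiceType) (rel : {malg K[X]} -> Prop).

Lemma pres_ind (P : pres rel -> Prop) : P 0 ->
  (forall k x p, P p -> P (k *: gen rel x + p)) -> forall p, P p.
Proof.
move=> P0 PS p; rewrite -[p]reprK (monalgE (repr p)).
elim: (enum_fset _) => [|x s IH]; first by rewrite big_nil linear0.
rewrite big_cons; set c := (repr p)@_x; set S := \sum_(_ <- _) _.
suff -> : << c *g x >> = c *: << x >> :> {malg K[X]} by rewrite linearP; exact: PS.
by apply/malgP => y; rewrite mcoeffZ !mcoeffU mulrnAr mulr1.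
Qed.

Lemma rel_gen r : rel r -> \pi_(pres rel) r = 0.
Proof.
move=> hr; rewrite -(linear0 (\pi_(pres rel))); apply/eqP/presE.
by rewrite subr0 -(addr0 r) -(scale1r r); exact: relspanP hr (relspan0 _).
Qed.

(** The product with structure constants [mu]. *)
Variable mu : X -> X -> pres rel.

Definition pmul (p q : pres rel) : pres rel := plift (fun x => plift (mu x) q) p.

Hypothesis mur : forall x, respects rel (mu x).
Hypothesis mul : forall y, respects rel (mu^~ y).

Lemma pmul_respects (q : pres rel) : respects rel (fun x => plift (mu x) q).
Proof.
move=> r hr; elim/pres_ind: q => [|k y q IH].
  by apply: big1 => x _; rewrite plift0 ?scaler0.
rewrite /mlext.
rewrite (eq_bigr (fun x => k *: (r@_x *: mu x y) + r@_x *: plift (mu x) q)).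
  rewrite /mlext in IH.
  by rewrite big_split -scaler_sumr /= IH addr0 -/(mlext (mu^~ y) r) mul // scaler0.
move=> x _; rewrite (plift_linear (mur x)) plift_gen // scalerDr !scalerA.
by rewrite mulrC.
Qed.

Lemma pmulPl k p p' q : pmul (k *: p + p') q = k *: pmul p q + pmul p' q.
Proof. exact: plift_linear (pmul_respects q) _ _ _. Qed.

Lemma pmulPr k p q q' : pmul p (k *: q + q') = k *: pmul p q + pmul p q'.
Proof.
have pliftE (f : X -> pres rel) :
  plift f p = \sum_(x <- msupp (repr p)) (repr p)@_x *: f x.
  by rewrite /plift unlock.
rewrite /pmul (pliftE (fun x => plift (mu x) (k *: q + q'))).
rewrite (pliftE (fun x => plift (mu x) q)) (pliftE (fun x => plift (mu x) q')).
rewrite scaler_sumr -big_split /=.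
apply: eq_bigr => x _.
by rewrite (plift_linear (mur x)) scalerDr !scalerA mulrC.
Qed.

Lemma pmul_gen x y : pmul (gen rel x) (gen rel y) = mu x y.
Proof. by rewrite /pmul plift_gen ?plift_gen //; exact: pmul_respects. Qed.

Lemma pmul0l q : pmul 0 q = 0.
Proof. by have := pmulPl (-1) 0 0 q; rewrite scaler0 addr0 scaleN1r addNr. Qed.

Lemma pmul0r p : pmul p 0 = 0.
Proof. by have := pmulPr (-1) p 0 0; rewrite scaler0 addr0 scaleN1r addNr. Qed.

Lemma pmulDl : left_distributive pmul +%R.
Proof. by move=> p p' q; have := pmulPl 1 p p' q; rewrite !scale1r. Qed.

Lemma pmulDr : right_distributive pmul +%R.
Proof. by move=> p q q'; have := pmulPr 1 p q q'; rewrite !scale1r. Qed.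

Lemma pmul_scaler k p q : pmul p (k *: q) = k *: pmul p q.
Proof. by have := pmulPr k p q 0; rewrite pmul0r !addr0. Qed.

Lemma pmul_scalel k p q : pmul (k *: p) q = k *: pmul p q.
Proof. by have := pmulPl k p 0 q; rewrite pmul0l !addr0. Qed.

Lemma pmulA :
  (forall x y z, pmul (gen rel x) (mu y z) = pmul (mu x y) (gen rel z)) ->
  associative pmul.
Proof.
move=> hA p q r; elim/pres_ind: p => [|k x p IHp]; first by rewrite !pmul0l.
rewrite (pmulPl k _ p (pmul q r)) (pmulPl k _ p q) (pmulPl k _ _ r) IHp.
have -> // : pmul (gen rel x) (pmul q r) = pmul (pmul (gen rel x) q) r.
clear p IHp.
elim/pres_ind: q => [|l y q IHq]; first by rewrite pmul0l pmul0r pmul0l.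
rewrite (pmulPl l _ q r) (pmulPr l _ _ (pmul q r)) (pmulPr l _ _ q).
rewrite (pmulPl l _ _ r) IHq.
have -> // : pmul (gen rel x) (pmul (gen rel y) r) =
  pmul (pmul (gen rel x) (gen rel y)) r.
clear q IHq.
elim/pres_ind: r => [|m z r IHr]; first by rewrite !pmul0r.
rewrite (pmulPr m _ _ r) (pmulPr m _ _ (pmul _ r)) (pmulPr m _ _ r) IHr.
by rewrite (pmul_gen y z) (pmul_gen x y) hA.
Qed.

Lemma pmul1l e : (forall x, mu e x = gen rel x) -> left_id (gen rel e) pmul.
Proof.
move=> he p; elim/pres_ind: p => [|k x p IH]; first exact: pmul0r.
by rewrite (pmulPr k _ _ p) IH (pmul_gen e x) he.
Qed.

Lemma pmul1r e : (forall x, mu x e = gen rel x) -> right_id (gen rel e) pmul.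
Proof.
move=> he p; elim/pres_ind: p => [|k x p IH]; first exact: pmul0l.
by rewrite (pmulPl k _ p) IH (pmul_gen x e) he.
Qed.

End PresentationTheory.

(** * Tensor products *)

Section Tensor.
Variables (K : fieldType) (U V : lmodType K).

Inductive tensor_rel : {malg K[(U * V)%type]} -> Prop :=
| tensor_rel_l k u u' v :
    tensor_rel (<< (k *: u + u', v) >> - (k *: << (u, v) >> + << (u', v) >>))
| tensor_rel_r k u v v' :
    tensor_rel (<< (u, k *: v + v') >> - (k *: << (u, v) >> + << (u, v') >>)).

Definition tensor : Type := pres tensor_rel.
HB.instance Definition _ := GRing.Lmodule.on tensor.

Definition tens (u : U) (v : V) : tensor := gen tensor_rel (u, v).

Lemma tensPl k u u' v : tens (k *: u + u') v = k *: tens u v + tens u' v.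
Proof.
apply/eqP; rewrite -subr_eq0 /tens /gen -linearP -linearB; apply/eqP.
by apply: rel_gen; exact: tensor_rel_l.
Qed.

Lemma tensPr k u v v' : tens u (k *: v + v') = k *: tens u v + tens u v'.
Proof.
apply/eqP; rewrite -subr_eq0 /tens /gen -linearP -linearB; apply/eqP.
by apply: rel_gen; exact: tensor_rel_r.
Qed.

Lemma respects_tensor (W : lmodType K) (f : U -> V -> W) :
  (forall k u u' v, f (k *: u + u') v = k *: f u v + f u' v) ->
  (forall k u v v', f u (k *: v + v') = k *: f u v + f u v') ->
  respects tensor_rel (fun uv => f uv.1 uv.2).
Proof.
move=> hl hr _ [k u u' v|k u v v']; rewrite linearB linearP /= !mlextU /=.
  by rewrite hl subrr.
by rewrite hr subrr.
Qed.

(** [m_K o (f (x) g)] *)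
Definition tensor_fun (f : {scalar U}) (g : {scalar V}) : tensor -> K :=
  @plift K (U * V)%type K^o tensor_rel (fun uv => f uv.1 * g uv.2).

Lemma tensor_fun_respects (f : {scalar U}) (g : {scalar V}) :
  @respects K (U * V)%type K^o tensor_rel (fun uv => f uv.1 * g uv.2).
Proof.
apply: (@respects_tensor K^o (fun u v => f u * g v)) => *.
  by rewrite linearP mulrDl /GRing.scale /= mulrA.
by rewrite linearP mulrDr /GRing.scale /= mulrCA.
Qed.

Lemma tensor_fun_linear f g : scalar (tensor_fun f g).
Proof. exact: plift_linear (tensor_fun_respects f g). Qed.

HB.instance Definition _ f g :=
  GRing.isLinear.Build K tensor K *%R (tensor_fun f g) (tensor_fun_linear f g).

Lemma tensor_funE f g u v : tensor_fun f g (tens u v) = f u * g v.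
Proof. exact: plift_gen (tensor_fun_respects f g). Qed.

End Tensor.
Arguments tensor {K} U V.

Section TensorAlgebra.
Variables (K : fieldType) (A B : algType K).

Definition tensor_mu (x y : (A * B)%type) : tensor A B := tens (x.1 * y.1) (x.2 * y.2).

Lemma tensor_mur x : respects (@tensor_rel K A B) (tensor_mu x).
Proof.
apply: (respects_tensor (f := fun a b => tens (x.1 * a) (x.2 * b))) => *.
  by rewrite mulrDr -scalerAr tensPl.
by rewrite mulrDr -scalerAr tensPr.
Qed.

Lemma tensor_mul y : respects (@tensor_rel K A B) (tensor_mu^~ y).
Proof.
apply: (respects_tensor (f := fun a b => tens (a * y.1) (b * y.2))) => *.
  by rewrite mulrDl -scalerAl tensPl.
by rewrite mulrDl -scalerAl tensPr.
Qed.

Lemma tensor_pmulA : associative (pmul tensor_mu).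
Proof.
apply: (pmulA tensor_mur tensor_mul) => -[a b] [c d] [e f].
rewrite (pmul_gen tensor_mur tensor_mul (a, b) (c * e, d * f)).
rewrite (pmul_gen tensor_mur tensor_mul (a * c, b * d) (e, f)).
by rewrite /tensor_mu /= !mulrA.
Qed.

Lemma tensor_pmul1l : left_id (tens 1 1 : tensor A B) (pmul tensor_mu).
Proof.
apply: (pmul1l tensor_mur tensor_mul) => -[a b].
by rewrite /tensor_mu /= !mul1r.
Qed.

Lemma tensor_pmul1r : right_id (tens 1 1 : tensor A B) (pmul tensor_mu).
Proof.
apply: (pmul1r tensor_mur tensor_mul) => -[a b].
by rewrite /tensor_mu /= !mulr1.
Qed.

HB.instance Definition _ := GRing.Zmodule_isPzRing.Build (tensor A B)
  tensor_pmulA tensor_pmul1l tensor_pmul1r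
  (pmulDl tensor_mur tensor_mul) (pmulDr tensor_mur).

Lemma tensM (a c : A) (b d : B) : tens a b * tens c d = tens (a * c) (b * d).
Proof. exact: (pmul_gen tensor_mur tensor_mul (a, b) (c, d)). Qed.

Lemma tensor_scalerAl k (x y : tensor A B) : k *: (x * y) = (k *: x) * y.
Proof. by rewrite /GRing.mul /= (pmul_scalel tensor_mur tensor_mul). Qed.

Lemma tensor_scalerAr k (x y : tensor A B) : k *: (x * y) = x * (k *: y).
Proof. by rewrite /GRing.mul /= (pmul_scaler tensor_mur). Qed.

End TensorAlgebra.

(** * Schröder trees *)

(** [Node t0 t1 ts] is the vertex with children [t0, t1] and then [ts]. *)
Inductive stree := Leaf | Node of stree & stree & seq stree.

Fixpoint stree_encode (t : stree) : GenTree.tree unit :=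
  if t is Node a b s then
    GenTree.Node 0 [:: stree_encode a, stree_encode b & map stree_encode s]
  else GenTree.Leaf tt.

Fixpoint stree_decode (g : GenTree.tree unit) : stree :=
  if g is GenTree.Node _ (a :: b :: s) then
    Node (stree_decode a) (stree_decode b) (map stree_decode s)
  else Leaf.

Fixpoint stree_nested_ind (P : stree -> Prop) (PL : P Leaf)
    (PN : forall a b s, P a -> P b -> foldr (fun c Q => P c /\ Q) True s ->
                        P (Node a b s)) (t : stree) : P t :=
  let rec := stree_nested_ind PL PN in
  match t with
  | Leaf => PL
  | Node a b s =>
    PN a b s (rec a) (rec b)
      ((fix go s : foldr (fun c Q => P c /\ Q) True s :=
          if s is c :: s' then conj (rec c) (go s') else I) s)
  end.

Lemma stree_encodeK : cancel stree_encode stree_decode.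
Proof.
elim/stree_nested_ind => //= a b s -> -> ihs; congr Node.
by elim: s ihs => //= c s IH [-> /IH ->].
Qed.

HB.instance Definition _ := Countable.copy stree (can_type stree_encodeK).

Definition children (t : stree) : seq stree :=
  if t is Node a b s then [:: a, b & s] else [::].

(** A vertex is represented by its address: the root is [[::]], and [i :: p] is
    the vertex of address [p] in the subtree rooted at the [i]-th child of the
    root.  The ancestors of a vertex (itself included) are thus the prefixes of
    its address. *)
Definition address := seq nat.

Definition under_children (L : seq (seq address)) : seq address :=
  flatten [seq [seq x.1 :: p | p <- x.2] | x <- zip (iota 0 (size L)) L].

(** From left to right. *)
Fixpoint leaves (t : stree) : seq address :=
  if t is Node a b s then
    under_children [:: leaves a, leaves b & map leaves s]
  else [:: [::]].

(** In prefix order; restricted to pairwise incomparable vertices this is the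
    order from left to right. *)
Fixpoint ivert (t : stree) : seq address :=
  if t is Node a b s then
    [::] :: under_children [:: ivert a, ivert b & map ivert s]
  else [::].

Definition nleaves (t : stree) : nat := size (leaves t).

Definition ST (n : nat) : pred stree := [pred t | nleaves t == n.+1].

Definition tdeg (t : stree) : nat := (nleaves t).-1.

Definition is_corolla (t : stree) : bool := size (ivert t) == 1%N.

Fixpoint lca (p q : address) : address :=
  match p, q with
  | i :: p', j :: q' => if i == j then i :: lca p' q' else [::]
  | _, _ => [::]
  end.

(** The [i]-th item (numbered from 0) is the last common ancestor of the leaves
    that bound the [i]-th sector. *)
Definition sectors (t : stree) : seq address :=
  [seq lca x.1 x.2 | x <- zip (leaves t) (behead (leaves t))].

(** [graft s t] grafts [s] on the leftmost leaf of [t]. *)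
Fixpoint graft (s t : stree) : stree :=
  if t is Node a b l then Node (graft s a) b l else s.

Inductive leftmost_grafting : stree -> Prop :=
| leftmost_grafting_leaf : leftmost_grafting Leaf
| leftmost_grafting_corolla t s :
    leftmost_grafting t -> is_corolla s -> leftmost_grafting (graft s t).

Definition BST (n : nat) (t : stree) : Prop :=
  t \in ST n /\ leftmost_grafting t.

(** ** The noncrossing partition of a tree *)

(** ['I_n] stands for the set of sectors. *)
Definition tree_partition (n : nat) (t : stree) : {set {set 'I_n}} :=
  [set:: [seq [set i : 'I_n | nth [::] (sectors t) i == v] | v <- ivert t]].

(** The product over [enum V] is taken in increasing order of the indices. *)
Definition phi_partition (K : fieldType) (A : algType K) (phi : A -> K) (n : nat)
    (P : {set {set 'I_n}}) (a : n.-tuple A) : K :=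
  \prod_(V in P) phi (\prod_(i <- enum V) tnth a i).

(** ** Admissible cuts *)

Definition Adm (t : stree) : {fset {fset address}} :=
  [fset c in fpowerset [fset v in ivert t] |
     all (fun l => #|` [fset v in c | prefix v l]| <= 1)%N (leaves t)]%fset.

Definition Adm_prec (t : stree) : {fset {fset address}} :=
  [fset c in Adm t | ~~ has (fun v => prefix v (head [::] (leaves t))) c]%fset.

Fixpoint prune (c : pred address) (t : stree) : stree :=
  if c [::] then Leaf else
  if t is Node a b s then
    Node (prune (fun p => c (0%N :: p)) a) (prune (fun p => c (1%N :: p)) b)
      ((fix go i s := if s is x :: s' then
                        prune (fun p => c (i :: p)) x :: go i.+1 s'
                      else [::]) 2 s)
  else Leaf.

Fixpoint subtree (t : stree) (p : address) : stree :=
  if p is i :: p' then subtree (nth Leaf (children t) i) p' else t.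

Definition cut_R (c : {fset address}) (t : stree) : stree :=
  prune (fun p => p \in c) t.

Definition cut_P (c : {fset address}) (t : stree) : seq stree :=
  [seq subtree t v | v <- ivert t & v \in c].

(** The sectors of [t] that become sectors of the trees of [cut_P c t]; the
    others become the sectors of [cut_R c t]. *)
Definition sectors_P (c : {fset address}) (t : stree) : seq bool :=
  [seq has (fun v => prefix v p) c | p <- sectors t].

Definition word_R (T : Type) c t (w : seq T) : seq T :=
  mask (map negb (sectors_P c t)) w.

Definition word_P (T : Type) c t (w : seq T) : seq T := mask (sectors_P c t) w.

(** * The Hopf algebra of decorated Schröder trees *)

Section HopfAlgebra.
Variables (K : fieldType) (A : lmodType K).

Definition fdeg (f : seq stree) : nat := \sum_(t <- f) tdeg t.

(** A forest, that is, a monomial of the free algebra on the Schröder trees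
    modulo [Leaf = 1], with a word of the same degree. *)
Definition is_dforest (x : seq stree * seq A) : bool :=
  (Leaf \notin x.1) && (size x.2 == fdeg x.1).

Definition dforest : Type := {x : seq stree * seq A | is_dforest x}.
HB.instance Definition _ := Choice.on dforest.

(** The forests of degree [n] are a basis of the homogeneous component of degree
    [n]: its tensor product with the [n]-th tensor power of [A] is generated by
    the pairs (forest of degree [n], word of length [n]), modulo linearity in
    each letter of the word. *)
Inductive HS_rel : {malg K[dforest]} -> Prop :=
| HS_rel_letter k f u a b v (x y z : dforest) :
    val x = (f, u ++ (k *: a + b) :: v) ->
    val y = (f, u ++ a :: v) -> val z = (f, u ++ b :: v) ->
    HS_rel (<< x >> - (k *: << y >> + << z >>)).

Definition HS : Type := pres HS_rel.
HB.instance Definition _ := GRing.Lmodule.on HS.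

(** [f (x) w], for a forest [f] in which single-vertex trees may occur (they are
    equal to 1) and a word [w] of length [fdeg f]; by convention, 0 if [w] does
    not have this length. *)
Definition dec (f : seq stree) (w : seq A) : HS :=
  if insub ([seq t <- f | t != Leaf], w) is Some x then gen HS_rel x else 0.

Lemma respects_HS (V : lmodType K) (F : seq stree -> seq A -> V) :
  (forall k f u a b v, Leaf \notin f -> size (u ++ a :: v) = fdeg f ->
     F f (u ++ (k *: a + b) :: v) = k *: F f (u ++ a :: v) + F f (u ++ b :: v)) ->
  respects HS_rel (fun x => F (val x).1 (val x).2).
Proof.
move=> hF _ [k f u a b v x y z hx hy hz].
rewrite linearB linearP /= !mlextU /= hx hy hz /= hF ?subrr //.
  by have /andP[] := valP y; rewrite hy.
by have /andP[_ /eqP] := valP y; rewrite hy.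
Qed.

Lemma fdeg_cat f g : fdeg (f ++ g) = (fdeg f + fdeg g)%N.
Proof. exact: big_cat. Qed.

Lemma filter_Leaf f : Leaf \notin f -> [seq t <- f | t != Leaf] = f.
Proof.
move=> hf; apply/all_filterP/allP => t ht.
by apply: contra hf => /eqP <-.
Qed.

Lemma fdeg_filter f : fdeg [seq t <- f | t != Leaf] = fdeg f.
Proof.
rewrite /fdeg big_filter [RHS](bigID (fun t => t != Leaf)) /=.
by rewrite [X in _ = (_ + X)%N]big1 ?addn0 // => t /negPn/eqP ->.
Qed.

Lemma decE (x : dforest) : dec (val x).1 (val x).2 = gen HS_rel x.
Proof.
rewrite /dec; have /andP[h _] := valP x; rewrite filter_Leaf //.
by case: (val x) (valK x) => f w /= ->.
Qed.

Lemma dec_default f w : size w != fdeg f -> dec f w = 0.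
Proof.
move=> h; rewrite /dec insubF // /is_dforest /= fdeg_filter (negbTE h).
by rewrite andbF.
Qed.

Lemma dec_filter f w : dec [seq t <- f | t != Leaf] w = dec f w.
Proof. by rewrite /dec filter_id. Qed.

Lemma dec_linear k f u a b v :
  dec f (u ++ (k *: a + b) :: v) = k *: dec f (u ++ a :: v) + dec f (u ++ b :: v).
Proof.
have [h|h] := eqVneq (size (u ++ a :: v)) (fdeg f); last first.
  rewrite !dec_default ?scaler0 ?addr0 //; move: h;
  by rewrite !size_cat.
have hd (c : A) : is_dforest ([seq t <- f | t != Leaf], u ++ c :: v).
  rewrite /is_dforest mem_filter eqxx /= fdeg_filter -h !size_cat /=.
  exact: eqxx.
rewrite /dec !insubT; apply/eqP; rewrite -subr_eq0 /gen -linearP -linearB.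
apply/eqP; apply: rel_gen.
by apply: (@HS_rel_letter k [seq t <- f | t != Leaf] u a b v).
Qed.

(** ** Product *)

Definition HS_mu (x y : dforest) : HS :=
  dec ((val x).1 ++ (val y).1) ((val x).2 ++ (val y).2).

Lemma HS_mur x : respects HS_rel (HS_mu x).
Proof.
apply: (respects_HS (F := fun f w => dec ((val x).1 ++ f) ((val x).2 ++ w))).
by move=> k f u a b v _ _; rewrite !catA dec_linear.
Qed.

Lemma HS_mul y : respects HS_rel (HS_mu^~ y).
Proof.
apply: (respects_HS (F := fun f w => dec (f ++ (val y).1) (w ++ (val y).2))).
by move=> k f u a b v _ _; rewrite -!catA !cat_cons dec_linear.
Qed.

Lemma dec_gen f w : size w = fdeg f ->
  exists2 x : dforest, dec f w = gen HS_rel x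
                     & val x = ([seq t <- f | t != Leaf], w).
Proof.
move=> h.
have hd : is_dforest ([seq t <- f | t != Leaf], w).
  by rewrite /is_dforest mem_filter eqxx /= fdeg_filter h.
by exists (Sub _ hd); rewrite ?SubK // /dec insubT.
Qed.

Lemma size_dforest (x : dforest) : size (val x).2 = fdeg (val x).1.
Proof. by have /andP[_ /eqP] := valP x. Qed.

Lemma HS_pmul_dec f g u v : size u = fdeg f -> size v = fdeg g ->
  pmul HS_mu (dec f u) (dec g v) = dec (f ++ g) (u ++ v).
Proof.
move=> /dec_gen[x -> hx] /dec_gen[y -> hy].
rewrite (pmul_gen HS_mur HS_mul x y) /HS_mu hx hy /= -filter_cat.
exact: dec_filter.
Qed.

Lemma HS_mulA : associative (pmul HS_mu).
Proof.
apply: (pmulA HS_mur HS_mul) => x y z.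
rewrite -(decE x) -(decE z) /HS_mu.
rewrite !HS_pmul_dec ?size_cat ?fdeg_cat ?size_dforest //.
by rewrite !catA.
Qed.

Lemma is_dforest1 : is_dforest ([::], [::]).
Proof. by rewrite /is_dforest /= /fdeg big_nil. Qed.

Definition dforest1 : dforest := Sub ([::], [::]) is_dforest1.

Lemma HS_mul1l : left_id (gen HS_rel dforest1) (pmul HS_mu).
Proof. by apply: (pmul1l HS_mur HS_mul) => x; rewrite -decE /HS_mu SubK. Qed.

Lemma HS_mul1r : right_id (gen HS_rel dforest1) (pmul HS_mu).
Proof.
by apply: (pmul1r HS_mur HS_mul) => x; rewrite -decE /HS_mu SubK /= !cats0.
Qed.

(** ** Counit *)

Definition counit : HS -> K :=
  @plift K dforest K^o HS_rel (fun x => ((val x).1 == [::])%:R).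

Lemma counit_respects :
  @respects K dforest K^o HS_rel (fun x => ((val x).1 == [::])%:R).
Proof.
apply: (@respects_HS K^o (fun f w => (f == [::])%:R)) => k f u a b v _.
case: f => [|t f] /=; last by rewrite scaler0 addr0.
by rewrite /fdeg big_nil size_cat /= addnS.
Qed.

Lemma counit_linear : scalar counit.
Proof. exact: plift_linear counit_respects. Qed.

HB.instance Definition _ :=
  GRing.isLinear.Build K HS K *%R counit counit_linear.

Lemma counit1 : counit (gen HS_rel dforest1) = 1.
Proof. by rewrite /counit (plift_gen _ counit_respects) SubK. Qed.

Lemma HS_oner_neq0 : gen HS_rel dforest1 != 0.
Proof.
apply/eqP => h; have := counit1; rewrite h linear0 => /eqP.
by rewrite eq_sym oner_eq0.
Qed.

HB.instance Definition _ := GRing.Zmodule_isNzRing.Build HS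
  HS_mulA HS_mul1l HS_mul1r (pmulDl HS_mur HS_mul) (pmulDr HS_mur) HS_oner_neq0.

Lemma HS_scalerAl (k : K) (x y : HS) : k *: (x * y) = (k *: x) * y.
Proof. by rewrite /GRing.mul /= (pmul_scalel HS_mur HS_mul). Qed.

HB.instance Definition _ := GRing.Lmodule_isLalgebra.Build K HS HS_scalerAl.

Lemma HS_scalerAr (k : K) (x y : HS) : k *: (x * y) = x * (k *: y).
Proof. by rewrite /GRing.mul /= (pmul_scaler HS_mur). Qed.

HB.instance Definition _ := GRing.Lalgebra_isAlgebra.Build K HS HS_scalerAr.

Lemma dec_nil : dec [::] [::] = 1.
Proof. by rewrite -[RHS](decE dforest1) SubK. Qed.

Lemma decM f g u v : size u = fdeg f -> size v = fdeg g ->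
  dec f u * dec g v = dec (f ++ g) (u ++ v).
Proof. exact: HS_pmul_dec. Qed.

Lemma HS_ind (P : HS -> Prop) : P 0 ->
  (forall k f w x, Leaf \notin f -> size w = fdeg f -> P x ->
     P (k *: dec f w + x)) ->
  forall x, P x.
Proof.
move=> P0 PS; apply: pres_ind => // k p x; rewrite -decE.
by apply: PS; [have /andP[] := valP p | exact: size_dforest].
Qed.

(** ** Coproduct and half-coproducts *)

Definition cut_sum (C : seq {fset address}) (t : stree) (w : seq A) :
    tensor HS HS :=
  \sum_(c <- C)
    tens (dec [:: cut_R c t] (word_R c t w)) (dec (cut_P c t) (word_P c t w)).

Definition delta_tree (t : stree) (w : seq A) : tensor HS HS :=
  cut_sum (Adm t) t w.

Definition delta_prec_tree (t : stree) (w : seq A) : tensor HS HS :=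
  cut_sum (Adm_prec t) t w.

Definition delta_succ_tree (t : stree) (w : seq A) : tensor HS HS :=
  delta_tree t w - delta_prec_tree t w.

Fixpoint delta_forest (f : seq stree) (w : seq A) : tensor HS HS :=
  if f is t :: f' then
    delta_tree t (take (tdeg t) w) * delta_forest f' (drop (tdeg t) w)
  else 1.

Definition delta_succ_forest (f : seq stree) (w : seq A) : tensor HS HS :=
  if f is t :: f' then
    delta_succ_tree t (take (tdeg t) w) * delta_forest f' (drop (tdeg t) w)
  else 0.

Definition delta : HS -> tensor HS HS :=
  plift (fun x => delta_forest (val x).1 (val x).2).

(** Extended by 0 on the unit. *)
Definition delta_succ : HS -> tensor HS HS :=
  plift (fun x => delta_succ_forest (val x).1 (val x).2).

Lemma size_sectors t : size (sectors t) = tdeg t.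
Proof.
rewrite size_map size_zip size_behead /tdeg /nleaves; apply/minn_idPr.
exact: leq_pred.
Qed.

Lemma cut_sum_linear C t k u a b v : size (u ++ a :: v) = tdeg t ->
  cut_sum C t (u ++ (k *: a + b) :: v) =
  k *: cut_sum C t (u ++ a :: v) + cut_sum C t (u ++ b :: v).
Proof.
move=> hs; rewrite /cut_sum scaler_sumr -big_split; apply: eq_bigr => c _ /=.
rewrite /word_R /word_P.
have: size (sectors_P c t) = size (u ++ a :: v).
  by rewrite size_map size_sectors hs.
move: (sectors_P c t) => m; rewrite size_cat /= => hm.
have hu : (size u < size m)%N by rewrite hm addnS ltnS leq_addr.
rewrite -(cat_take_drop (size u) m) (drop_nth false hu).
have h1 : size (take (size u) m) = size u by rewrite size_take hu.
have h2 : size (map negb (take (size u) m)) = size u by rewrite size_map.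
rewrite !map_cat !mask_cat //=.
by case: nth => /=; rewrite dec_linear ?tensPr ?tensPl.
Qed.

Lemma delta_tree_linear t k u a b v : size (u ++ a :: v) = tdeg t ->
  delta_tree t (u ++ (k *: a + b) :: v) =
  k *: delta_tree t (u ++ a :: v) + delta_tree t (u ++ b :: v).
Proof. exact: cut_sum_linear. Qed.

Lemma delta_succ_tree_linear t k u a b v : size (u ++ a :: v) = tdeg t ->
  delta_succ_tree t (u ++ (k *: a + b) :: v) =
  k *: delta_succ_tree t (u ++ a :: v) + delta_succ_tree t (u ++ b :: v).
Proof.
move=> h; rewrite /delta_succ_tree /delta_tree /delta_prec_tree.
by rewrite !cut_sum_linear // scalerBr opprD addrACA.
Qed.

Lemma fdeg_cons t f : fdeg (t :: f) = (tdeg t + fdeg f)%N.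
Proof. exact: big_cons. Qed.

Lemma take_drop_letter (n : nat) (u v : seq A) a : size (u ++ a :: v) = n ->
  forall m, (m <= n)%N ->
  (exists v1 v2, [/\ size (u ++ a :: v1) = m,
     forall c, take m (u ++ c :: v) = u ++ c :: v1 &
     forall c, drop m (u ++ c :: v) = v2]) \/
  (exists u1 u2, [/\ size (u2 ++ a :: v) = (n - m)%N,
     forall c, take m (u ++ c :: v) = u1 &
     forall c, drop m (u ++ c :: v) = u2 ++ c :: v]).
Proof.
move=> <- m; rewrite size_cat /= => hm; have [h|h] := leqP m (size u).
  right; exists (take m u), (drop m u); split=> [|c|c].
  - by rewrite size_cat size_drop /= addnBAC.
  - rewrite take_cat; case: ltnP => // h'.
    have -> : m = size u by apply/eqP; rewrite eqn_leq h.
    by rewrite subnn take0 cats0 take_size.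
  rewrite drop_cat; case: ltnP => // h'.
  have -> : m = size u by apply/eqP; rewrite eqn_leq h.
  by rewrite subnn drop0 drop_size.
left; exists (take (m - size u).-1 v), (drop (m - size u).-1 v).
have hpos : (m - size u)%N = (m - size u).-1.+1 by rewrite prednK ?subn_gt0.
split=> [|c|c].
- rewrite size_cat /= size_takel; first by rewrite -hpos subnKC // ltnW.
  by rewrite -ltnS -hpos leq_subLR.
- by rewrite take_cat ltnNge (ltnW h) /= hpos.
by rewrite drop_cat ltnNge (ltnW h) /= hpos.
Qed.

Lemma delta_forest_linear k f u a b v : size (u ++ a :: v) = fdeg f ->
  delta_forest f (u ++ (k *: a + b) :: v) =
  k *: delta_forest f (u ++ a :: v) + delta_forest f (u ++ b :: v).
Proof.
elim: f u => [|t f IH] u hs /=.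
  by move: hs; rewrite /fdeg big_nil size_cat /= addnS.
have hle : (tdeg t <= fdeg (t :: f))%N by rewrite fdeg_cons leq_addr.
case: (take_drop_letter hs hle) => [[v1 [v2 [h1 h2 h3]]]|[u1 [u2 [h1 h2 h3]]]].
  by rewrite !h2 !h3 delta_tree_linear // mulrDl tensor_scalerAl.
rewrite !h2 !h3 IH; last by rewrite h1 fdeg_cons addKn.
by rewrite mulrDr tensor_scalerAr.
Qed.

Lemma delta_succ_forest_linear k f u a b v : size (u ++ a :: v) = fdeg f ->
  delta_succ_forest f (u ++ (k *: a + b) :: v) =
  k *: delta_succ_forest f (u ++ a :: v) + delta_succ_forest f (u ++ b :: v).
Proof.
case: f => [|t f] hs /=; first by rewrite scaler0 addr0.
have hle : (tdeg t <= fdeg (t :: f))%N by rewrite fdeg_cons leq_addr.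
case: (take_drop_letter hs hle) => [[v1 [v2 [h1 h2 h3]]]|[u1 [u2 [h1 h2 h3]]]].
  by rewrite !h2 !h3 delta_succ_tree_linear // mulrDl tensor_scalerAl.
rewrite !h2 !h3 delta_forest_linear; last by rewrite h1 fdeg_cons addKn.
by rewrite mulrDr tensor_scalerAr.
Qed.

Lemma delta_respects :
  respects HS_rel (fun x => delta_forest (val x).1 (val x).2).
Proof.
apply: (respects_HS (F := delta_forest)) => k f u a b v _.
exact: delta_forest_linear.
Qed.

Lemma delta_succ_respects :
  respects HS_rel (fun x => delta_succ_forest (val x).1 (val x).2).
Proof.
apply: (respects_HS (F := delta_succ_forest)) => k f u a b v _.
exact: delta_succ_forest_linear.
Qed.

Lemma delta_linear : linear delta.
Proof. exact: plift_linear delta_respects. Qed.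

Lemma delta_succ_linear : linear delta_succ.
Proof. exact: plift_linear delta_succ_respects. Qed.

HB.instance Definition _ :=
  GRing.isLinear.Build K HS (tensor HS HS) *:%R delta delta_linear.

HB.instance Definition _ :=
  GRing.isLinear.Build K HS (tensor HS HS) *:%R delta_succ delta_succ_linear.

Lemma delta_dec f w : Leaf \notin f -> size w = fdeg f ->
  delta (dec f w) = delta_forest f w.
Proof.
move=> hf /dec_gen[x -> hx].
by rewrite /delta (plift_gen _ delta_respects) hx /= filter_Leaf.
Qed.

Lemma delta_succ_dec f w : Leaf \notin f -> size w = fdeg f ->
  delta_succ (dec f w) = delta_succ_forest f w.
Proof.
move=> hf /dec_gen[x -> hx].
by rewrite /delta_succ (plift_gen _ delta_succ_respects) hx /= filter_Leaf.
Qed.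

Lemma delta_dec_tree t w : t != Leaf -> size w = tdeg t ->
  delta (dec [:: t] w) = delta_tree t w.
Proof.
move=> ht hw; rewrite delta_dec ?inE 1?eq_sym //.
  by rewrite /= -hw take_size mulr1.
by rewrite fdeg_cons /fdeg big_nil addn0.
Qed.

Lemma delta_succ_dec_tree t w : t != Leaf -> size w = tdeg t ->
  delta_succ (dec [:: t] w) = delta_succ_tree t w.
Proof.
move=> ht hw; rewrite delta_succ_dec ?inE 1?eq_sym //.
  by rewrite /= -hw take_size mulr1.
by rewrite fdeg_cons /fdeg big_nil addn0.
Qed.

Lemma delta_forest_cat f g u v : size u = fdeg f ->
  delta_forest (f ++ g) (u ++ v) = delta_forest f u * delta_forest g v.
Proof.
elim: f u => [|t f IH] u /=.
  by rewrite /fdeg big_nil => /size0nil ->; rewrite mul1r.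
rewrite fdeg_cons => hu; have hle : (tdeg t <= size u)%N by rewrite hu leq_addr.
have -> : drop (tdeg t) (u ++ v) = drop (tdeg t) u ++ v.
  rewrite drop_cat; case: ltnP => // h.
  have -> : tdeg t = size u by apply/eqP; rewrite eqn_leq hle h.
  by rewrite subnn drop0 drop_size.
rewrite (takel_cat v hle).
rewrite (IH (drop (tdeg t) u)); last by rewrite size_drop hu addKn.
exact: mulrA.
Qed.

Lemma delta1 : delta 1 = 1.
Proof. by rewrite -dec_nil delta_dec // /fdeg big_nil. Qed.

Lemma deltaM : {morph delta : x y / x * y}.
Proof.
move=> x y; elim/HS_ind: x => [|k f u x hf hu IHx].
  by rewrite mul0r linear0 mul0r.
rewrite (mulrDl _ x y) -HS_scalerAl [LHS]linearP /= IHx.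
rewrite (linearP delta k _ x) (mulrDl _ (delta x)) -tensor_scalerAl.
have -> // : delta (dec f u * y) = delta (dec f u) * delta y.
elim/HS_ind: y {x IHx} => [|l g v y hg hv IHy].
  by rewrite mulr0 linear0 mulr0.
rewrite (mulrDr (dec f u) _ y) -HS_scalerAr [LHS]linearP /= IHy.
rewrite (linearP delta l _ y) (mulrDr _ _ (delta y)) -tensor_scalerAr.
have -> // : delta (dec f u * dec g v) = delta (dec f u) * delta (dec g v).
rewrite (decM hu hv) (delta_dec hf hu) (delta_dec hg hv) delta_dec.
- exact: delta_forest_cat.
- by rewrite mem_cat negb_or hf.
- by rewrite size_cat fdeg_cat hu hv.
Qed.

(** ** Functionals *)

(** [m_K o (f (x) g) o delta_succ], with value 0 on the unit. *)
Definition conv_succ (f g : {scalar HS}) (x : HS) : K :=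
  tensor_fun f g (delta_succ x).

Definition character (f : {scalar HS}) : Prop :=
  f 1 = 1 /\ forall x y, f (x * y) = f x * f y.

(** The augmentation ideal is the kernel of [counit]. *)
Definition infinitesimal_character (f : {scalar HS}) : Prop :=
  f 1 = 0 /\ forall x y, counit x = 0 -> counit y = 0 -> f (x * y) = 0.

End HopfAlgebra.
Arguments HS {K} A.
Arguments dec {K A} f w.
Arguments counit {K A}.

(** The value 1 on the single-vertex tree is part of [character Phi]. *)
Definition extending_character (K : fieldType) (A : algType K) (phi : {scalar A})
    (Phi : {scalar (HS A)}) : Prop :=
  character Phi /\
  forall (n : nat) (t : stree) (a : n.-tuple A), (0 < n)%N -> t \in ST n ->
    Phi (dec [:: t] a) = if is_corolla t then phi (\prod_(i < n) tnth a i) else 0.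

(* Main.v *)
Require Import Defs.
From mathcomp Require Import all_boot all_order all_algebra finmap.
From mathcomp Require Import reals complex.

Set Implicit Arguments.
Unset Strict Implicit.
Unset Printing Implicit Defensive.

Import GRing.Theory.
Local Open Scope ring_scope.

(** Write a tree as a root with leftmost child [a] and other children [b :: s].
    Evaluate [Phi = counit + conv_succ Phi beta] on it, decorated by [w].  The
    cuts occurring in the right half-coproduct are those that contain an
    ancestor of the leftmost leaf, and nearly all of them contribute 0:
    - a cut with two elements or more is killed by the infinitesimal character
      [beta], which vanishes on products;
    - the cut [{v}], with [v] at depth 2 or more on the leftmost branch, leaves
      a pruned tree in which both the root and its leftmost child are internal;
      this is not a corolla, hence [Phi] kills it.
    There remain the cut at the root, which contributes [beta] of the tree
    itself, and, if [a] is not a leaf, the cut at the leftmost child.  This is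
    the recursion [beta_Node]:
      [beta (t (x) w) = Phi (t (x) w) - Phi (t' (x) w'') * beta (a (x) w')],
    where [t'] is [t] with [a] replaced by a leaf, and [w = w' w''] is the
    splitting of [w] into the decorations of [a] and of [t'].  If [a] is not a
    leaf then [t] is not a corolla and the first term vanishes, while the second
    requires [t'] to be a corolla.

    Unfolding the recursion along the leftmost branch ([beta_left_comb]), [beta]
    vanishes unless every internal vertex is on that branch, and such a tree
    gets one value of [phi] for each internal vertex and one sign for each edge
    between them.  These left combs are exactly the iterated leftmost graftings
    of corollas ([left_combP]), and the product of the values of [phi] is the
    one attached to the noncrossing partition of the tree
    ([phi_partition_tree]). *)

(** * Vertices, leaves and sectors below a root *)

(** [under_children] with the numbering of the children shifted by [k], so that
    the first child can be split off. *)
Definition under_from (k : nat) (L : seq (seq address)) : seq address :=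
  flatten [seq [seq x.1 :: p | p <- x.2] | x <- zip (iota k (size L)) L].

Lemma under_from_cons k x L :
  under_from k (x :: L) = map (cons k) x ++ under_from k.+1 L.
Proof. by []. Qed.

Lemma under_from_children x L :
  under_children (x :: L) = map (cons 0%N) x ++ under_from 1 L.
Proof. by []. Qed.

Lemma mem_under_from k L i p : i :: p \in under_from k L ->
  (k <= i)%N && (p \in nth [::] L (i - k)).
Proof.
elim: L k => [|x L IH] k //; rewrite under_from_cons mem_cat => /orP[].
  by case/mapP => q hq [-> ->]; rewrite leqnn subnn.
move/IH => /andP[h]; rewrite (ltnW h) /= => hp.
by rewrite -(subnSK h).
Qed.

Lemma nil_notin_under_from k L : [::] \notin under_from k L.
Proof.
elim: L k => [|x L IH] k //; rewrite under_from_cons mem_cat negb_or IH andbT.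
by apply/mapP => -[].
Qed.

(** Being neither the leftmost child of the root nor below it; the root itself
    qualifies, whence the default 1. *)
Definition off_left (p : address) : bool := head 1%N p != 0%N.

Lemma prefix0_off_left p : prefix [:: 0%N] p = ~~ off_left p.
Proof. by case: p => [|[|i] p] //=; rewrite prefix0s. Qed.

Lemma under_from_off_left k L : all off_left (under_from k.+1 L).
Proof. by apply/allP => -[|[|i] p] // /mem_under_from /andP[]. Qed.

Lemma ivert_nil t : (ivert t == [::]) = (t == Leaf).
Proof. by case: t. Qed.

Lemma under_from_ivert_nil k s :
  (under_from k (map ivert s) == [::]) = all (pred1 Leaf) s.
Proof.
elim: s k => [|t s IH] k //=; rewrite under_from_cons -(IH k.+1) -ivert_nil.
by case: (ivert t).
Qed.

Lemma is_corolla_Node a b s :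
  is_corolla (Node a b s) = (a == Leaf) && all (pred1 Leaf) (b :: s).
Proof.
rewrite /is_corolla [LHS]eqSS size_eq0.
exact: (under_from_ivert_nil 0 [:: a, b & s]).
Qed.

(** The trees cut off have positive degree: single-vertex trees, equal to 1,
    would not count as factors of a forest. *)
Lemma subtree_ivert t v : v \in ivert t -> subtree t v != Leaf.
Proof.
elim: v t => [|i p IH] [|a b s] //=; rewrite inE /=.
move/(@mem_under_from 0) => /andP[_]; rewrite subn0 => hp; apply: IH.
rewrite -[[:: ivert a, _ & _]]/(map ivert [:: a, b & s]) in hp.
have [hi|hi] := ltnP i (size [:: a, b & s]).
  by rewrite (nth_map Leaf) in hp.
by rewrite nth_default ?size_map in hp.
Qed.

Lemma leaves_neq_nil t : leaves t != [::].
Proof.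
elim/stree_nested_ind: t => // a b s ha _ _ /=.
by rewrite under_from_children; case: (leaves a) ha.
Qed.

Lemma tdeg_gt0 t : (0 < tdeg t)%N = (t != Leaf).
Proof.
case: t => // a b s; rewrite /tdeg /nleaves /= under_from_children.
rewrite under_from_cons !size_cat !size_map.
case: (leaves a) (leaves_neq_nil a) (leaves b) (leaves_neq_nil b) => // x l _.
by case=> //= y r _; rewrite addnS.
Qed.

Lemma tdeg_Node a b s :
  tdeg (Node a b s) = (tdeg a + tdeg (Node Leaf b s))%N.
Proof.
rewrite /tdeg /nleaves /= !under_from_children !size_cat !size_map /=.
by case: (leaves a) (leaves_neq_nil a).
Qed.

(** The sectors of a tree as a function of its list of leaves. *)
Definition lcas (L : seq address) : seq address :=
  [seq lca x.1 x.2 | x <- zip L (behead L)].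

(** The two pieces are joined by the sector between the last leaf of the first
    one and the first leaf of the second one. *)
Lemma lcas_cat x L1 y L2 : lcas ((x :: L1) ++ y :: L2) =
  lcas (x :: L1) ++ lca (last x L1) y :: lcas (y :: L2).
Proof. by elim: L1 x => [|z L1 IH] x //=; rewrite {1}/lcas /= -/(lcas _) IH. Qed.

Lemma lcas_map_cons k L : lcas (map (cons k) L) = map (cons k) (lcas L).
Proof.
case: L => // x L; elim: L x => [|y L IH] x //.
by move: (IH y); rewrite /lcas /= eqxx => ->.
Qed.

Lemma lcas_off_left L : all off_left L -> all off_left (lcas L).
Proof.
case: L => // u L; elim: L u => [|z L IH] u // /andP[hu hL].
rewrite [lcas _]/= -/(lcas (z :: L)) [all _ _]/= (IH z hL) andbT.
by case: u hu => [|i u] hi //; case: z {hL} => [|j z] //=; case: eqP.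
Qed.

(** The sectors inside the leftmost subtree come first; the next one lies between
    the first two children of the root, hence belongs to the root. *)
Lemma sectors_Node a b s : sectors (Node a b s) =
  map (cons 0%N) (sectors a) ++
    [::] :: lcas (under_from 1 (leaves b :: map leaves s)).
Proof.
rewrite -[sectors a]/(lcas (leaves a)) -[sectors _]/(lcas (leaves _)) /=.
rewrite under_from_children [under_from 1 _]under_from_cons.
case: (leaves a) (leaves_neq_nil a) => // x L1 _.
case: (leaves b) (leaves_neq_nil b) => // y L2 _.
rewrite !map_cons (cat_cons (1%N :: y)) lcas_cat last_map.
by rewrite -map_cons lcas_map_cons.
Qed.

(** * Cuts at the root and at the leftmost child *)

Lemma prune_false c t : c =1 (fun=> false) -> prune c t = t.
Proof.
elim/stree_nested_ind: t c => [|a b s ha hb hs] c hc /=; rewrite hc //.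
rewrite ha ?hb; try by move=> p; exact: hc.
congr Node; elim: s (2%:R : nat) hs => [|x s IH] i //= [hx hs].
by rewrite hx ?IH // => p; exact: hc.
Qed.

Lemma cut_R_root t : cut_R [fset [::]]%fset t = Leaf.
Proof. by rewrite /cut_R; case: t => /=; rewrite inE eqxx. Qed.

Lemma cut_R_left a b s :
  cut_R [fset [:: 0%N]]%fset (Node a b s) = Node Leaf b s.
Proof.
rewrite /cut_R /= inE /=.
have -> : prune (fun p => 0%N :: p \in [fset [:: 0%N]]%fset) a = Leaf.
  by case: a => /=; rewrite inE.
rewrite prune_false => [|p]; last by rewrite inE.
(* The remaining children have positive numbers, unlike the cut one. *)
congr Node; rewrite -[2%:R]/(1%N.+1).
elim: s 1%N => [|x s IH] i //=.
by rewrite IH prune_false // => p; rewrite inE.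
Qed.

(** After a cut strictly below the leftmost child, the root and this child are
    both internal. *)
Lemma cut_R_deep_left p a b s : p != [::] -> p \in ivert a ->
  cut_R [fset 0%N :: p]%fset (Node a b s) != Leaf /\
  is_corolla (cut_R [fset 0%N :: p]%fset (Node a b s)) = false.
Proof.
rewrite /cut_R; case: a => // a1 a2 s1 hp _.
by rewrite /= !inE /= eqseq_cons eqxx /= eq_sym (negbTE hp) is_corolla_Node.
Qed.

Lemma cut_P_root t : t != Leaf -> cut_P [fset [::]]%fset t = [:: t].
Proof.
case: t => // a b s _; rewrite /cut_P /= inE eqxx /=; congr (_ :: _).
rewrite (@eq_in_filter _ _ pred0) ?filter_pred0 // => p hp.
rewrite inE; apply/eqP => hp0; move: hp.
rewrite hp0 -[under_children _]/(under_from 0 _).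
by rewrite (negbTE (nil_notin_under_from _ _)).
Qed.

Lemma cut_P_left a b s : a != Leaf ->
  cut_P [fset [:: 0%N]]%fset (Node a b s) = [:: a].
Proof.
move=> ha; rewrite /cut_P /= inE /= under_from_children filter_cat.
rewrite [X in _ ++ X](@eq_in_filter _ _ pred0) ?filter_pred0 ?cats0; last first.
  move=> p /(allP (under_from_off_left 0 _)); rewrite inE.
  by apply: contraNF => /eqP ->.
rewrite filter_map -map_comp -[RHS](cut_P_root ha) /cut_P.
by congr map; apply: eq_filter => p; rewrite /= !inE eqseq_cons.
Qed.

Lemma sectors_P_root t : sectors_P [fset [::]]%fset t = nseq (tdeg t) true.
Proof.
rewrite /sectors_P -size_sectors; elim: (sectors t) => //= p l ->.
by congr (_ :: _); apply/hasP; exists [::]; rewrite ?inE ?prefix0s.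
Qed.

(** Here the decorations that go to the left subtree form an initial segment of
    the word. *)
Lemma sectors_P_left a b s : exists m,
  sectors_P [fset [:: 0%N]]%fset (Node a b s) =
    nseq (tdeg a) true ++ nseq m false.
Proof.
have hE p :
    has (fun v => prefix v p) [fset [:: 0%N]]%fset = ~~ off_left p.
  rewrite -prefix0_off_left; apply/hasP/idP => [[v]|h].
    by rewrite inE => /eqP ->.
  by exists [:: 0%N]; rewrite ?inE.
rewrite /sectors_P (eq_map hE) sectors_Node map_cat -size_sectors.
have := lcas_off_left (under_from_off_left 0 (leaves b :: map leaves s)).
move: (lcas _) => r hoff; exists (size r).+1; congr cat.
  by elim: (sectors a) => //= p l ->.
by congr (_ :: _); elim: r hoff => //= p l IH /andP[-> /IH ->].
Qed.

Lemma mask_initial_segment (T : Type) k m (w : seq T) : size w = (k + m)%N ->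
  mask (nseq k true ++ nseq m false) w = take k w /\
  mask (map negb (nseq k true ++ nseq m false)) w = drop k w.
Proof.
move=> hw; have hk : size (take k w) = k by rewrite size_takel ?hw ?leq_addr.
have hm : size (drop k w) = m by rewrite size_drop hw addKn.
rewrite -{1 3}(cat_take_drop k w) map_cat !map_nseq.
rewrite !mask_cat ?size_nseq // !mask_false cats0.
by rewrite !mask_true ?hk ?hm.
Qed.

(** * The recursion along the leftmost branch *)

Section Recursion.
Variables (K : fieldType) (A : algType K).
Implicit Types (w : seq A) (t : stree) (f : seq stree).

Lemma fdeg1 t : fdeg [:: t] = tdeg t.
Proof. by rewrite fdeg_cons /fdeg big_nil addn0. Qed.

Lemma counit_dec f w : Leaf \notin f -> f != [::] -> counit (dec f w) = 0.
Proof.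
move=> hf f0; have [hw|hw] := eqVneq (size w) (fdeg f); last first.
  by rewrite dec_default // linear0.
have [x -> hx] := dec_gen hw.
rewrite /counit (plift_gen _ (@counit_respects K A)) hx filter_Leaf //.
by rewrite (negbTE f0).
Qed.

(** Without its first tree, the forest is still in the augmentation ideal. *)
Lemma infinitesimal_character_forest (beta : {scalar (HS A)}) f w :
  infinitesimal_character beta -> Leaf \notin f -> (1 < size f)%N ->
  beta (dec f w) = 0.
Proof.
case: f => [|t [|u f]] // [_ hbeta] hf _.
have [hw|hw] := eqVneq (size w) (fdeg [:: t, u & f]); last first.
  by rewrite dec_default // linear0.
move: hf; rewrite inE negb_or => /andP[ht hf].
rewrite fdeg_cons in hw.
rewrite -(cat_take_drop (tdeg t) w) -[_ :: _]/([:: t] ++ _) -decM.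
- by apply: hbeta; apply: counit_dec => //; rewrite inE.
- by rewrite fdeg1 size_takel // hw leq_addr.
- by rewrite size_drop hw addKn.
Qed.

Lemma dec_Leaf (w : seq A) : size w = 0%N -> dec [:: Leaf] w = 1.
Proof. by move/size0nil => ->; rewrite -dec_nil -dec_filter. Qed.

(** Subtracting the left half-coproduct leaves the cuts that contain an ancestor
    of the leftmost leaf. *)
Lemma conv_succ_tree (f g : {scalar (HS A)}) t w :
  t != Leaf -> size w = tdeg t ->
  conv_succ f g (dec [:: t] w) =
    \sum_(c <- Adm t | has (fun v => prefix v (head [::] (leaves t))) c)
       f (dec [:: cut_R c t] (word_R c t w)) * g (dec (cut_P c t) (word_P c t w)).
Proof.
move=> ht hw; rewrite /conv_succ delta_succ_dec_tree // /delta_succ_tree.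
rewrite linearB /delta_tree /delta_prec_tree /cut_sum !linear_sum.
under eq_bigr do rewrite /= tensor_funE.
under [X in _ - X]eq_bigr do rewrite /= tensor_funE.
rewrite [X in X - _](bigID (fun c : {fset address} =>
  has (fun v => prefix v (head [::] (leaves t))) c)) /=.
by rewrite /Adm_prec [X in _ - X]big_fset addrK.
Qed.

Lemma Adm_fset1 t v : v \in ivert t -> [fset v]%fset \in Adm t.
Proof.
move=> hv; rewrite !inE /= fpowersetE fsub1set !inE /= hv /=.
apply/allP => l _; rewrite -(cardfs1 v); apply: fsubset_leq_card.
by apply/fsubsetP => u; rewrite !inE => /andP[].
Qed.

Lemma Adm_sub t c : c \in Adm t -> {subset c <= ivert t}.
Proof.
by rewrite !inE /= fpowersetE => /andP[/fsubsetP h _] v /h; rewrite !inE.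
Qed.

Lemma size_cut_P t c : c \in Adm t -> (#|` c| <= size (cut_P c t))%N.
Proof.
move=> hc; rewrite size_map; apply: uniq_leq_size => // v hv.
by rewrite mem_filter hv (Adm_sub hc).
Qed.

Lemma cut_P_Leaf c t : Leaf \notin cut_P c t.
Proof.
apply/mapP => -[v]; rewrite mem_filter => /andP[_ hv] h.
by have := subtree_ivert hv; rewrite -h eqxx.
Qed.

Variables (phi : {scalar A}) (Phi : {scalar (HS A)}).
Hypothesis Phi_phi : extending_character phi Phi.

Lemma extending_character_tree t w : t != Leaf -> size w = tdeg t ->
  Phi (dec [:: t] w) = if is_corolla t then phi (\prod_(x <- w) x) else 0.
Proof.
move=> ht hw; have [_ h] := Phi_phi.
have hn : t \in ST (tdeg t).
  by rewrite inE /tdeg prednK // lt0n size_eq0 leaves_neq_nil.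
have := h _ _ (Tuple (introT eqP hw)) _ hn.
by rewrite tdeg_gt0 => -> //; rewrite -(big_tuple _ _ _ xpredT id).
Qed.

Variable beta : {scalar (HS A)}.
Hypothesis beta_inf : infinitesimal_character beta.
Hypothesis Phi_beta : forall x : HS A, Phi x = counit x + conv_succ Phi beta x.

(** The cancellation behind the recursion: [beta] kills the cuts with several
    elements, [Phi] the cuts at a single vertex deep in the leftmost branch. *)
Lemma cut_term_eq0 a b s w c (t := Node a b s) : c \in Adm t ->
  has (fun v => prefix v (head [::] (leaves t))) c ->
  c != [fset [::]]%fset -> c != [fset [:: 0%N]]%fset ->
  Phi (dec [:: cut_R c t] (word_R c t w)) *
  beta (dec (cut_P c t) (word_P c t w)) = 0.
Proof.
move=> hc /hasP[v vc hv] croot cleft.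
have [c1|c1] := ltnP 1 #|` c|.
  rewrite [X in _ * X]infinitesimal_character_forest ?mulr0 ?cut_P_Leaf //.
  exact: leq_trans c1 (size_cut_P hc).
(* The cut is a single vertex, an ancestor of the leftmost leaf. *)
have [u cu] : exists u, c = [fset u]%fset.
  apply/cardfs1P; rewrite eqn_leq c1 cardfs_gt0.
  by apply/fset0Pn; exists v.
have {u cu} cv : c = [fset v]%fset by move: vc; rewrite cu inE => /eqP ->.
have := Adm_sub hc vc; rewrite {}cv {c vc c1} in hc croot cleft *.
case: v hv croot cleft {hc} => [|i p]; first by rewrite eqxx.
rewrite /t /= under_from_children.
case: (leaves a) (leaves_neq_nil a) => // x l _ /= /andP[/eqP -> _] _ hp.
rewrite inE /= under_from_children mem_cat => /orP[|]; last first.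
  by move/(allP (under_from_off_left _ _)).
rewrite mem_map => [|p1 p2 []//] hpa.
have p0 : p != [::] by apply: contraNneq hp => ->.
(* What remains is not a corolla; if the word does not fit, [dec] is 0. *)
have [h1 h2] := cut_R_deep_left b s p0 hpa.
move: (word_R _ _ _) => w'.
have [hw|hw] := eqVneq (size w') (tdeg (cut_R [fset 0%N :: p]%fset (Node a b s))).
  by rewrite extending_character_tree // h2 mul0r.
by rewrite dec_default ?linear0 ?mul0r // fdeg1.
Qed.

(** The equation defining [beta], solved for the term of the cut at the root. *)
Lemma beta_Node a b s w : size w = tdeg (Node a b s) ->
  beta (dec [:: Node a b s] w) = Phi (dec [:: Node a b s] w) -
    (if a == Leaf then 0 else
     Phi (dec [:: Node Leaf b s] (drop (tdeg a) w)) *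
     beta (dec [:: a] (take (tdeg a) w))).
Proof.
move=> hw; rewrite [Phi (dec [:: Node a b s] w)]Phi_beta counit_dec // add0r.
rewrite conv_succ_tree // big_mkcond /=.
rewrite (big_fsetD1 [fset [::]]%fset) ?Adm_fset1 ?inE //=.
have hroot : has (fun v => prefix v (head [::] (leaves (Node a b s))))
  [fset [::]]%fset.
  by apply/hasP; exists [::]; rewrite ?inE ?prefix0s.
rewrite [X in if X then _ else _]hroot cut_R_root cut_P_root //.
have hm := @mask_initial_segment A (tdeg (Node a b s)) 0 w.
rewrite addn0 cats0 in hm; have [hP hR] := hm hw.
rewrite /word_R /word_P sectors_P_root hP hR dec_Leaf; last first.
  by rewrite size_drop hw subnn.
(* The cut at the root contributes [Phi 1 * beta (dec [:: t] w)]. *)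
have [[-> _] _] := Phi_phi.
rewrite mul1r -hw take_size -addrA -[LHS]addr0; congr (_ + _).
have [ha|ha] := eqVneq a Leaf.
  rewrite subr0 big1_fset // => c; rewrite in_fsetD1 => /andP[croot hc] _.
  case: ifP => // hhas; apply: cut_term_eq0 => //.
  apply/negP => /eqP cleft; move: hc; rewrite cleft => /Adm_sub.
  move/(_ [:: 0%N] (fset11 _)); rewrite ha /= under_from_children inE /=.
  by move/(allP (under_from_off_left _ _)).
apply/eqP; rewrite eq_sym subr_eq0; apply/eqP.
have left_ivert : [:: 0%N] \in ivert (Node a b s).
  by rewrite /= under_from_children; case: a ha {hw hroot hm hP hR}.
rewrite (big_fsetD1 [fset [:: 0%N]]%fset) /=; last first.
  rewrite in_fsetD1 Adm_fset1 // andbT; apply/negP => /eqP/fsetP/(_ [::]).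
  by rewrite !inE.
rewrite [X in _ + X]big1_fset ?addr0; last first.
  move=> c; rewrite in_fsetD1 => /andP[cleft]; rewrite in_fsetD1.
  case/andP => croot hc _; case: ifP => // hhas; exact: cut_term_eq0.
have hleft : has (fun v => prefix v (head [::] (leaves (Node a b s))))
  [fset [:: 0%N]]%fset.
  apply/hasP; exists [:: 0%N]; rewrite ?inE //= under_from_children.
  by case: (leaves a) (leaves_neq_nil a) => //= x l _; rewrite prefix0s.
rewrite [X in if X then _ else _]hleft cut_R_left cut_P_left //.
have [m hm'] := sectors_P_left a b s.
have := congr1 size hm'; rewrite size_map size_sectors size_cat !size_nseq.
rewrite -hw => /mask_initial_segment[{}hP {}hR].
by rewrite /word_R /word_P hm' hP hR.
Qed.

End Recursion.

(** * Left combs *)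

(** The iterated leftmost graftings of corollas, in a form that descends to the
    leftmost subtree as the recursion [beta_Node] does. *)
Fixpoint left_comb (t : stree) : bool :=
  if t is Node a b s then all (pred1 Leaf) (b :: s) && left_comb a else true.

Lemma left_comb_Node a b s :
  left_comb (Node a b s) = all (pred1 Leaf) (b :: s) && left_comb a.
Proof. by []. Qed.

Lemma left_comb_graft s t : is_corolla s -> left_comb t -> left_comb (graft s t).
Proof.
move=> hs; elim/stree_nested_ind: t => [|a b l IH _ _ /= /andP[-> /IH]] //= _.
case: s hs => // a b l; rewrite is_corolla_Node /= => /andP[/eqP -> ->] //.
Qed.

(** Growing a comb at its leftmost leaf adds a corolla at the bottom, whereas the
    recursion on trees peels one off at the top; both proofs use that grafting
    commutes with adding a root below which only the leftmost child is not a
    leaf. *)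
Lemma left_combP t : reflect (leftmost_grafting t) (left_comb t).
Proof.
apply: (iffP idP); last by elim=> // u s _ IH hs; exact: left_comb_graft.
elim/stree_nested_ind: t => [|a b l IH _ _ /= /andP[hl /IH {IH}]].
  by move=> _; exact: leftmost_grafting_leaf.
elim=> [|u s hu IH hs].
  rewrite -[Node _ _ _]/(graft (Node Leaf b l) Leaf).
  apply: leftmost_grafting_corolla leftmost_grafting_leaf _.
  by rewrite is_corolla_Node.
by rewrite -[Node _ _ _]/(graft s (Node u b l)); exact: leftmost_grafting_corolla.
Qed.

Lemma ivert_left_comb a b s : all (pred1 Leaf) (b :: s) ->
  ivert (Node a b s) = [::] :: map (cons 0%N) (ivert a).
Proof.
rewrite -(under_from_ivert_nil 1) => /eqP h.
by rewrite /= under_from_children h cats0.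
Qed.

Lemma under_from_leaves k s : all (pred1 Leaf) s ->
  under_from k (map leaves s) = [seq [:: i] | i <- iota k (size s)].
Proof.
elim: s k => [|t s IH] k //= /andP[/eqP -> hs].
by rewrite under_from_cons IH.
Qed.

Lemma lcas_singletons k m :
  lcas [seq [:: i] | i <- iota k m.+1] = nseq m [::].
Proof.
elim: m k => [|m IH] k //; move: (IH k.+1).
by rewrite /lcas /= => ->; rewrite ltn_eqF.
Qed.

Lemma sectors_left_comb a b s : all (pred1 Leaf) (b :: s) ->
  sectors (Node a b s) =
    map (cons 0%N) (sectors a) ++ nseq (size s).+1 [::].
Proof.
move=> h; rewrite sectors_Node (under_from_leaves 1 h).
by rewrite (lcas_singletons 1 (size s)).
Qed.

Lemma uniq_ivert_left_comb t : left_comb t -> uniq (ivert t).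
Proof.
elim/stree_nested_ind: t => // a b s IH _ _ /andP[hl /IH ua].
rewrite ivert_left_comb // cons_uniq map_inj_uniq ?ua => [|p q []//].
by rewrite andbT; apply/mapP => -[].
Qed.

(** An internal vertex has at least two children, hence at least one sector. *)
Lemma ivert_sub_sectors_left_comb t :
  left_comb t -> {subset ivert t <= sectors t}.
Proof.
elim/stree_nested_ind: t => // a b s IH _ _ /andP[hl /IH {}IH] v.
rewrite ivert_left_comb // sectors_Node mem_cat inE => /orP[/eqP ->|].
  by rewrite inE eqxx orbT.
by case/mapP => p /IH hp ->; rewrite map_f.
Qed.

(** * The partition of a tree *)

Definition block_word (T : Type) (t : stree) (w : seq T) (v : address) : seq T :=
  mask (map (pred1 v) (sectors t)) w.

Lemma block_word_root (T : Type) a b s (w : seq T) :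
  all (pred1 Leaf) (b :: s) -> size w = tdeg (Node a b s) ->
  block_word (Node a b s) w [::] = drop (tdeg a) w.
Proof.
move=> hl hw; rewrite /block_word sectors_left_comb //.
have [_ <-] : mask (nseq (tdeg a) true ++ nseq (size s).+1 false) w =
    take (tdeg a) w /\
  mask (map negb (nseq (tdeg a) true ++ nseq (size s).+1 false)) w =
    drop (tdeg a) w.
  apply: mask_initial_segment; rewrite hw -!size_sectors sectors_left_comb //.
  by rewrite size_cat size_map size_nseq.
rewrite !map_cat -map_comp !map_nseq /= -size_sectors; congr (mask (_ ++ _) _).
by elim: (sectors a) => //= p l ->.
Qed.

Lemma block_word_left (T : Type) a b s (w : seq T) v :
  size w = tdeg (Node a b s) ->
  block_word (Node a b s) w (0%N :: v) = block_word a (take (tdeg a) w) v.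
Proof.
move=> hw; rewrite /block_word sectors_Node map_cat -{1}(cat_take_drop (tdeg a) w).
rewrite mask_cat; last first.
  by rewrite 2!size_map size_sectors size_takel // hw tdeg_Node leq_addr.
have /all_pred1P -> : all (pred1 false) (map (pred1 (0%N :: v))
    ([::] :: lcas (under_from 1 (leaves b :: map leaves s)))).
  rewrite all_map /=.
  apply: sub_all (lcas_off_left (under_from_off_left 0 (leaves b :: map leaves s))).
  by move=> p hp /=; rewrite eqbF_neg; apply: contraTneq hp => ->.
by rewrite mask_false cats0 -map_comp.
Qed.

(** A product over a set of blocks becomes a product over the vertices: different
    vertices have different blocks because no block is empty. *)
Lemma phi_partition_tree (K : fieldType) (A : algType K) (phi : A -> K)
    (n : nat) (t : stree) (a : n.-tuple A) :
  t \in ST n -> uniq (ivert t) -> {subset ivert t <= sectors t} ->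
  phi_partition phi (tree_partition n t) a =
    \prod_(v <- ivert t) phi (\prod_(x <- block_word t a v) x).
Proof.
rewrite inE => /eqP ht hu hsub.
have hn : size (sectors t) = n by rewrite size_sectors /tdeg ht.
pose B v := [set i : 'I_n | nth [::] (sectors t) i == v].
rewrite /phi_partition /tree_partition -/B.
have B_inj : {in ivert t &, injective B}.
  move=> u v /hsub hu1 _ /setP Buv.
  have hi : (index u (sectors t) < n)%N by rewrite -[ltnRHS]hn index_mem.
  have := Buv (Ordinal hi); rewrite !inE /= nth_index // eqxx.
  by move/esym/eqP.
rewrite (eq_bigl (mem (map B (ivert t)))); last by move=> V; rewrite inE.
rewrite -big_uniq ?map_inj_in_uniq // big_map; apply: eq_bigr => v _.
congr phi; rewrite /block_word.
have -> : sectors t = [seq nth [::] (sectors t) (nat_of_ord i) | i <- enum 'I_n].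
  rewrite -[LHS](mkseq_nth [::]) hn /mkseq -val_enum_ord -map_comp.
  exact: eq_map.
have -> : a = [seq tnth a i | i <- enum 'I_n] :> seq A.
  by rewrite map_tnth_enum.
rewrite -map_comp -map_mask big_map -filter_mask.
rewrite enumT; congr (\prod_(i <- _) _).
by rewrite /enum_mem; apply: eq_filter => i; rewrite inE in_set.
Qed.

(** * The values of the infinitesimal character *)

Section Cumulant.
Variables (K : fieldType) (A : algType K).
Variables (phi : {scalar A}) (Phi beta : {scalar (HS A)}).
Hypothesis Phi_phi : extending_character phi Phi.
Hypothesis beta_inf : infinitesimal_character beta.
Hypothesis Phi_beta : forall x : HS A, Phi x = counit x + conv_succ Phi beta x.

(** Each step of the recursion turns the letters at the root into one value of
    [phi] and, unless it is the last one, changes the sign. *)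
Lemma beta_left_comb t (w : seq A) : t != Leaf -> size w = tdeg t ->
  beta (dec [:: t] w) =
    if left_comb t then
      (-1) ^+ (size (ivert t)).-1 *
        \prod_(v <- ivert t) phi (\prod_(x <- block_word t w v) x)
    else 0.
Proof.
elim/stree_nested_ind: t w => // a b s IH _ _ w _ hw.
rewrite (beta_Node Phi_phi) // (extending_character_tree Phi_phi) //.
have hR : size (drop (tdeg a) w) = tdeg (Node Leaf b s).
  by rewrite size_drop hw tdeg_Node addKn.
rewrite (extending_character_tree Phi_phi _ hR) // !is_corolla_Node.
rewrite left_comb_Node eqxx andTb.
case hl: (all _ _); last by rewrite mul0r if_same andbF subr0.
rewrite andbT andTb ivert_left_comb // big_cons big_map block_word_root //.
have [a0|ha] := eqVneq a Leaf.
  by rewrite a0 drop0 big_nil expr0 mul1r mulr1 subr0.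
have hl' : size (take (tdeg a) w) = tdeg a.
  by rewrite size_takel // hw tdeg_Node leq_addr.
rewrite sub0r (IH _ ha hl').
case: ifP => _; last by rewrite mulr0 oppr0.
have -> : size ([::] :: map (cons 0%N) (ivert a)) = (size (ivert a)).-1.+2.
  by rewrite /= size_map prednK // lt0n size_eq0 ivert_nil.
rewrite exprS mulN1r mulNr mulrCA; congr (- (_ * (_ * _))).
by apply: eq_bigr => v _; rewrite block_word_left.
Qed.

End Cumulant.

Theorem proposition6p1 (R : realType) (A : algType R[i])
    (phi : {scalar A}) (phi1 : phi 1 = 1)
    (n : nat) (n_gt0 : (0 < n)%N) (t : stree) (t_ST : t \in ST n)
    (a : n.-tuple A)
    (Phi : {scalar (HS A)}) (Phi_phi : extending_character phi Phi)
    (beta : {scalar (HS A)}) (beta_inf : infinitesimal_character beta)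
    (Phi_beta : forall x : HS A, Phi x = counit x + conv_succ Phi beta x) :
  (BST n t ->
     beta (dec [:: t] a) =
       (-1) ^+ (size (ivert t)).-1 * phi_partition phi (tree_partition n t) a) /\
  (~ BST n t -> beta (dec [:: t] a) = 0).
Proof.
have tn : tdeg t = n by rewrite /tdeg (eqP t_ST).
have t0 : t != Leaf by rewrite -tdeg_gt0 tn.
have := beta_left_comb Phi_phi beta_inf Phi_beta t0 (etrans (size_tuple a) (esym tn)).
case: ifP => [ht ->|ht ->]; split.
- move=> _; rewrite phi_partition_tree ?uniq_ivert_left_comb //.
  exact: ivert_sub_sectors_left_comb.
- by case; split=> //; apply/left_combP.
- by case=> _ /left_combP; rewrite ht.
- by [].
Qed.
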